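(* Let $k\geq 3$, let $I\subseteq\mathbb{Z}^+$ be a finite nonempty set, and let $t=\max(I)+k-1$. Let $c_{I,k}$ be the constant such that $d_k(I,n)=c_{I,k}f_k(n)(1+O(n^{-0.49}))$ as $n\to\infty$. Then \[c_{I,k}=\frac{1}{t!\,r_k^t}\int_0^1\varphi_k(x)\int_0^x\sum_{s=1}^t d_k(r_t(I),t+1-s,t)\,\Phi^t_s(y)\,\mathrm{d}y\,\mathrm{d}x.\]
   Context: For $w\in S_n$, $D_k(w)$ is the set of indices $i$ with $1\le i\le n-k+1$ and $w(i)>w(i+1)>\cdots>w(i+k-1)$. For finite $J\subseteq\mathbb{Z}^+$, $d_k(J,n)$ is the number of $w\in S_n$ with $D_k(w)=J$; $d_k(J,m,n)$ is the number of those with in addition $w(1)=m$; and $f_k(n)=d_k(\emptyset,n)$. The existence of the constant $c_{I,k}$ with $d_k(I,n)=c_{I,k}f_k(n)(1+O(n^{-0.49}))$ (implied constant depending on $k,I$) is a theorem of the paper; it equals $\lim_{n\to\infty} d_k(I,n)/f_k(n)$. For $I=\{i_1,\ldots,i_\ell\}$ and $t\ge\max(I)+k-1$, $r_t(I)=\{t+2-k-i_1,\ldots,t+2-k-i_\ell\}$ (a set; not to be confused with the real constant $r_k$). The constant $r_k>0$ is the one in the known theorem of Ehrenborg, Kitaev and Perry: for each $k\ge2$ there are real $c_k>0$, $r_k>0$, $0\le\gamma_k<1$ with $f_k(n)=n!\,c_k\,r_k^n(1+O_k(\gamma_k^n))$ (this determines $r_k$ uniquely). Define \[\varphi_k(x)=\frac{1}{r_k}\left(1-\frac{(x/r_k)^{k-1}}{(k-1)!}+\frac{(x/r_k)^k}{k!}-\frac{(x/r_k)^{2k-1}}{(2k-1)!}+\frac{(x/r_k)^{2k}}{(2k)!}-\cdots\right),\]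 and for $1\le s\le t$ and $y\in[0,1]$, \[\Phi^t_s(y)=\frac{t!}{(s-1)!(t-s)!}y^{s-1}(1-y)^{t-s}.\] *)

(* Defs.v *)
From mathcomp Require Import all_boot all_order all_algebra all_fingroup.
From mathcomp Require Import finmap.
From mathcomp Require Import all_classical all_reals all_analysis.
Import Order.TTheory GRing.Theory Num.Theory.
Import numFieldNormedType.Exports.

Set Implicit Arguments.
Unset Strict Implicit.
Unset Printing Implicit Defensive.

(* Permutations of {1, ..., n} are encoded as 'S_n, which permutes
   {0, ..., n-1}: [perm_at w i] is w(i) for 1 <= i <= n, with both the position
   and the value counted from 1, and is the junk value 0 when i > n. *)
Definition perm_at (n : nat) (w : 'S_n) (i : nat) : nat :=
  nth 0 [seq (w j).+1 | j <- enum 'I_n] i.-1.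

(* The positions 1 <= i <= n - k + 1 with w(i) > w(i+1) > ... > w(i+k-1).
   The bound is written [n.+1 - k] because [n - k + 1] with truncated
   subtraction would be wrong for n < k. *)
Definition descent_runs (k n : nat) (w : 'S_n) : {fset nat} :=
  [fset i in iota 1 (n.+1 - k) |
    [forall j : 'I_k.-1, perm_at w (i + j.+1) < perm_at w (i + j)]]%fset.

Definition num_runs (k : nat) (J : {fset nat}) (n : nat) : nat :=
  #|[set w : 'S_n | descent_runs k w == J]|.

Definition num_runs_first (k : nat) (J : {fset nat}) (m n : nat) : nat :=
  #|[set w : 'S_n | (descent_runs k w == J) && (perm_at w 1 == m)]|.

Definition num_avoid (k n : nat) : nat := num_runs k fset0 n.

(* All subtractions are exact when t >= max(I) + k - 1. *)
Definition reflect_runs (k t : nat) (I : {fset nat}) : {fset nat} :=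
  [fset (t + 2 - k - i)%N | i in I]%fset.

Local Open Scope classical_set_scope.
Local Open Scope ring_scope.

(* u n = v n * (1 + O(g n)) as n goes to infinity *)
Definition asymp_mul1O (R : realType) (u v g : nat -> R) : Prop :=
  exists2 e : nat -> R, e =O_\oo g & \forall n \near \oo, u n = v n * (1 + e n).

(* r is the constant r_k of the Ehrenborg-Kitaev-Perry theorem *)
Definition is_growth_rate (R : realType) (k : nat) (r : R) : Prop :=
  0 < r /\
  exists c gamma : R, [/\ 0 < c, 0 <= gamma < 1 &
    asymp_mul1O (fun n => (num_avoid k n)%:R)
                (fun n => n`!%:R * c * r ^+ n)
                (fun n => gamma ^+ n)].

Definition is_run_constant (R : realType) (k : nat) (I : {fset nat}) (c : R) :
    Prop :=
  asymp_mul1O (fun n => (num_runs k I n)%:R)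
              (fun n => c * (num_avoid k n)%:R)
              (fun n => n%:R `^ (- (49%:R / 100%:R))).

(* The exponents 0, k-1, k, 2k-1, 2k, ... occurring in the series of phi_k *)
Definition phi_exp (k i : nat) : nat := (uphalf i * k - odd i)%N.

Definition phi (R : realType) (k : nat) (r x : R) : R :=
  r^-1 * limn (series (fun i : nat =>
    (-1) ^+ i * (x / r) ^+ phi_exp k i / (phi_exp k i)`!%:R)).

(* The density of the s-th smallest of t independent uniform variables on
   [0, 1], for 1 <= s <= t *)
Definition order_density (R : realType) (t s : nat) (y : R) : R :=
  t`!%:R / ((s.-1)`!%:R * (t - s)`!%:R) * y ^+ s.-1 * (1 - y) ^+ (t - s).

(* Main.v *)
From HB Require Import structures.
Require Import Defs.
From mathcomp Require Import all_boot all_order all_algebra all_fingroup.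
From mathcomp Require Import finmap.
From mathcomp Require Import all_classical all_reals all_analysis.
From mathcomp Require Import measurable_realfun.
From mathcomp Require Import zify ring lra.
Import Order.TTheory GRing.Theory Num.Theory.
Import numFieldNormedType.Exports.
Local Open Scope classical_set_scope.
Local Open Scope ring_scope.

Set Implicit Arguments.
Unset Strict Implicit.
Unset Printing Implicit Defensive.

(** The formula comes from an exact expansion of d_k(I,n) / n! in terms of the
    probabilities f_k(j) / j!, to which the limit is applied term by term.

    A permutation has run set I, with t = max I + k - 1, exactly when its first
    t letters have run set I, the letter t + 1 is an ascent, and the letters
    from t + 1 on contain no decreasing run of k letters ([word_runs_cat]).
    Permutations are replaced by points of a cube with independent uniform
    coordinates. The density of the last coordinate of the points with a given
    descent word is a polynomial, obtained from 1 by the operators [rise] and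
    [fall], one for each ascent or descent ([sum_perm_words]). Hence
    d_k(I,n) / n! is the result of applying the operators of all avoiding
    continuations to [rise P], where P is the density for the prefixes with run
    set I ([num_runs_avoid_int]).

    Since [rise] plus [fall] is integration over the unit interval, inclusion
    and exclusion on the first run of the continuation gives the recursion
    [avoid_int_rec] and, unfolded, the alternating sum [avoid_int_sum] over the
    exponents e = 0, k-1, k, 2k-1, 2k, ... of f_k(j) / j! times the integral of
    x^e / e! against [rise P], with j + e constant. After division by r^n the
    factor f_k(j) / j! becomes a constant times r^(-e) in the limit; the terms
    are dominated geometrically ([tannery]), so the limit is the series [phi]
    integrated against [rise P] ([cvg_phi_integral], [cvg_avoid_int]). The
    hypothesis on c evaluates the same limit ([cvg_run_constant]).

    Finally t! P is the inner integrand: grouping prefixes by their last letter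
    yields the densities of order statistics, and reversing and complementing a
    prefix turns its last letter into a first one ([sum_order_density]). *)

(** * Formal integration of polynomials *)

Section Antiderivative.
Variable R : numFieldType.
Implicit Types (p q : {poly R}) (x : R).

(** At [i = 0] the coefficient is [p`_0 / 0 = 0], the constant of integration
    that makes the antiderivative vanish at 0. *)
Definition antideriv p : {poly R} := \poly_(i < (size p).+1) (p`_i.-1 / i%:R).

Lemma coef_antideriv p i : (antideriv p)`_i = p`_i.-1 / i%:R.
Proof.
rewrite coef_poly; case: ltnP => // lt_p_i.
by rewrite nth_default ?mul0r // -ltnS (ltn_predK lt_p_i).
Qed.

Lemma antideriv_is_linear : linear antideriv.
Proof.
move=> a p q; apply/polyP => i.
by rewrite coefD coefZ !coef_antideriv coefD coefZ mulrDl mulrA.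
Qed.
HB.instance Definition _ :=
  GRing.isLinear.Build R {poly R} {poly R} *:%R antideriv antideriv_is_linear.

Lemma deriv_antideriv p : (antideriv p)^`() = p.
Proof.
apply/polyP => i; rewrite coef_deriv coef_antideriv /=.
by rewrite -(mulr_natr (_ / _)) mulfVK ?pnatr_eq0.
Qed.

Lemma horner0_antideriv p : (antideriv p).[0] = 0.
Proof. by rewrite horner_coef0 coef_antideriv invr0 mulr0. Qed.

Lemma antideriv_deriv p : antideriv p^`() = p - p.[0]%:P.
Proof.
apply/polyP => i; rewrite coef_antideriv coef_deriv coefB coefC horner_coef0.
case: i => [|i]; first by rewrite invr0 mulr0 subrr.
by rewrite subr0 -(mulr_natr p`_i.+1) mulfK // pnatr_eq0.
Qed.

Lemma antiderivP p q : p^`() = q -> p.[0] = 0 -> antideriv q = p.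
Proof. by move=> <- p0; rewrite antideriv_deriv p0 subr0. Qed.

Definition integ01 p : R := (antideriv p).[1].

Lemma integ01_is_linear : linear_for *%R integ01.
Proof. by move=> a p q; rewrite /integ01 linearP hornerD hornerZ. Qed.
HB.instance Definition _ :=
  GRing.isLinear.Build R {poly R} R *%R integ01 integ01_is_linear.

(** If [p x] is the density, at the value x of the last coordinate, of the
    points of a unit cube whose coordinates have a given pattern of ascents and
    descents, then [rise p] and [fall p] are the densities after one more
    coordinate, placed above, respectively below, the last one. *)
Definition rise p : {poly R} := antideriv p.
HB.instance Definition _ := GRing.Linear.copy rise antideriv.
Definition fall p : {poly R} := (integ01 p)%:P - antideriv p.

Lemma fall_is_linear : linear fall.
Proof.
move=> a p q; rewrite /fall !linearP /= polyCD polyCM mul_polyC.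
by rewrite scalerDr addrACA.
Qed.
HB.instance Definition _ :=
  GRing.isLinear.Build R {poly R} {poly R} *:%R fall fall_is_linear.

(** A new coordinate that is free of the last one forgets the past: the density
    becomes constant. This is what cuts a long pattern into independent
    pieces. *)
Lemma rise_add_fall p : rise p + fall p = (integ01 p)%:P.
Proof. by rewrite addrC subrK. Qed.

Lemma fallP p q : p^`() = - q -> p.[1] = 0 -> fall q = p.
Proof.
move=> dp p1; rewrite -[q]opprK -dp linearN /= /fall /integ01.
rewrite antideriv_deriv !hornerE p1.
by rewrite sub0r polyCN; ring.
Qed.

(** Integration by parts; the boundary terms vanish because [antideriv q] is 0
    at 0 and [fall p] is 0 at 1. *)
Lemma integ01M_fall p q : integ01 (q * fall p) = integ01 (antideriv q * p).
Proof.
apply/eqP; rewrite -subr_eq0 -linearB /=; apply/eqP.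
have -> : q * fall p - antideriv q * p = (antideriv q * fall p)^`().
  rewrite derivM deriv_antideriv /fall derivB derivC deriv_antideriv.
  by rewrite sub0r mulrN.
rewrite /integ01 antideriv_deriv hornerD hornerN hornerC !hornerM.
rewrite horner0_antideriv mul0r subr0.
by rewrite /fall hornerD hornerN hornerC subrr mulr0.
Qed.

(** Normalized so that integration shifts the exponent. *)
Definition divpow e : {poly R} := e`!%:R^-1 *: 'X^e.

Lemma antideriv_divpow e : antideriv (divpow e) = divpow e.+1.
Proof.
apply: antiderivP; last by rewrite /divpow !hornerE exprS mul0r mulr0.
rewrite /divpow derivZ derivXn -scalerMnr scalerMnl; congr (_ *: _).
rewrite factS natrM -[LHS]mulr_natr.
by rewrite invfM mulrAC mulVf ?mul1r // pnatr_eq0.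
Qed.

(** The volume of the points below x that start a decreasing chain of length e
    is x^e / e!. These are the terms of the series [phi]. *)
Lemma integ01_iter_fall e p : integ01 (iter e fall p) = integ01 (divpow e * p).
Proof.
have -> : iter e fall p = divpow 0 * iter e fall p.
  by rewrite /divpow fact0 invr1 scale1r mul1r.
rewrite -[in RHS](add0n e).
elim: e 0%N => [|e IHe] d; first by rewrite addn0.
by rewrite iterS integ01M_fall antideriv_divpow IHe addSnnS.
Qed.

Lemma integ01_coef p : integ01 p = \sum_(i < size p) p`_i / i.+1%:R.
Proof.
rewrite /integ01 /antideriv horner_poly big_ord_recl invr0 mulr0 mul0r add0r.
by apply: eq_bigr => i _; rewrite expr1n mulr1.
Qed.

Lemma integ01_divpowM_bound p e :
  `|integ01 (divpow e * p)| <= (\sum_(i < size p) `|p`_i|) / e`!%:R.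
Proof.
rewrite -scalerAl linearZ /= normrM ger0_norm ?invr_ge0 ?ler0n //.
rewrite mulrC ler_wpM2r ?invr_ge0 ?ler0n //.
rewrite -[X in 'X^e * X]coefK poly_def mulr_sumr linear_sum /=.
apply: le_trans (ler_norm_sum _ _ _) _; apply: ler_sum => i _.
rewrite -scalerAr -exprD linearZ /= normrM.
rewrite ler_piMr // integ01_coef size_polyXn big_ord_recr /= big1 ?add0r.
  rewrite coefXn eqxx mul1r ger0_norm ?invr_ge0 ?ler0n // invf_le1 ?ltr0n //.
  by rewrite ler1n.
by move=> j _; rewrite coefXn ltn_eqF ?mul0r.
Qed.

Lemma deriv_divpow e : (divpow e.+1)^`() = divpow e.
Proof. by rewrite -antideriv_divpow deriv_antideriv. Qed.

Lemma horner_divpow e x : (divpow e).[x] = x ^+ e / e`!%:R.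
Proof. by rewrite /divpow !hornerE mulrC. Qed.

(** The density of the last coordinate of the points ordered like a given
    permutation of n+1 letters with last letter m, counted from 0. Multiplied by
    (n+1)! it is the density of the order statistic of rank m. It is extended by
    0 to m > n so that the telescoping sums below need no boundary cases. *)
Definition bernpoly n m : {poly R} :=
  divpow m * (divpow (n - m) \Po (1 - 'X)) *+ (m <= n)%N.

Lemma horner_bernpoly n m x : (m <= n)%N ->
  (bernpoly n m).[x] =
    x ^+ m * (1 - x) ^+ (n - m) / (m`!%:R * (n - m)`!%:R).
Proof.
move=> le_mn; rewrite /bernpoly le_mn hornerM horner_comp !horner_divpow.
have -> : (1 - 'X).[x] = 1 - x by rewrite !hornerE.
by rewrite invfM mulrACA.
Qed.

Lemma deriv_bernpoly n m :
  (bernpoly n.+1 m)^`() =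
    (if m is m'.+1 then bernpoly n m' else 0) - bernpoly n m.
Proof.
have dcomp e : (divpow e.+1 \Po (1 - 'X))^`() = - (divpow e \Po (1 - 'X)).
  by rewrite deriv_comp deriv_divpow derivB derivX derivC sub0r mulrN mulr1.
have comp0 : (divpow 0 \Po (1 - 'X))^`() = 0.
  by rewrite deriv_comp /divpow expr0 alg_polyC derivC comp_polyC mul0r.
have d0 : (divpow 0)^`() = 0 by rewrite /divpow expr0 alg_polyC derivC.
rewrite /bernpoly derivMn derivM.
case: m => [|m]; first by rewrite d0 !subn0 dcomp mul0r add0r sub0r mulrN.
rewrite deriv_divpow !ltnS subSS; case: (ltngtP m n) => [lt_mn|//|->].
- by rewrite !mulr1n -[(n - m)%N]subnSK // dcomp mulrN.
- by rewrite subr0.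
- by rewrite subnn comp0 mulr0 addr0 subr0.
Qed.

(** Inserting a last letter j after a last letter m creates an ascent exactly
    when j > m; the derivatives of the right-hand side telescope. *)
Lemma rise_bernpoly n m : (m <= n)%N ->
  rise (bernpoly n m) = \sum_(m.+1 <= j < n.+2) bernpoly n.+1 j.
Proof.
move=> le_mn; apply: antiderivP; last first.
  rewrite horner_sum big_nat big1 // => j /andP[lt_mj le_jn].
  rewrite horner_bernpoly // expr0n gtn_eqF ?mul0r //.
  exact: leq_ltn_trans lt_mj.
rewrite raddf_sum big_add1 /=.
under eq_bigr do rewrite deriv_bernpoly -opprB.
rewrite sumrN telescope_sumr ?opprB; last by rewrite ltnW.
by rewrite [bernpoly n n.+1]/bernpoly ltnn subr0.
Qed.

Lemma fall_bernpoly n m : (m <= n)%N ->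
  fall (bernpoly n m) = \sum_(0 <= j < m.+1) bernpoly n.+1 j.
Proof.
move=> le_mn; apply: fallP; last first.
  rewrite horner_sum big_nat big1 // => j /andP[_ le_jm].
  rewrite horner_bernpoly; last by lia.
  by rewrite subrr expr0n subSn ?mulr0 ?mul0r //; lia.
rewrite raddf_sum /=.
pose h j := if j is j'.+1 then bernpoly n j' else 0.
under eq_bigr do rewrite deriv_bernpoly -opprB -[X in X - _]/(h _.+1).
by rewrite sumrN telescope_sumr // subr0.
Qed.

Lemma integ01_bernpoly n m : (m <= n)%N ->
  integ01 (bernpoly n m) = (n.+1)`!%:R^-1.
Proof.
move=> le_mn.
rewrite /integ01 -[antideriv _]/(rise _) rise_bernpoly // horner_sum.
rewrite big_nat_recr //= big_nat big1 ?add0r => [|j /andP[_ lt_jn]].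
  rewrite horner_bernpoly // subnn !expr1n expr0 fact0 mulr1 mul1r.
  by rewrite mulr1.
rewrite horner_bernpoly; last exact: ltnW.
by rewrite subrr expr0n subSn // mulr0 mul0r.
Qed.

End Antiderivative.

(** * Sums over binary words *)

Section WordSums.

Fixpoint sum_words (V : nmodType) (n : nat) (F : seq bool -> V) : V :=
  if n is n'.+1 then
    sum_words n' (fun u => F (true :: u)) +
    sum_words n' (fun u => F (false :: u))
  else F [::].

Lemma eq_sum_words (V : nmodType) n (F G : seq bool -> V) :
  (forall u, size u = n -> F u = G u) -> sum_words n F = sum_words n G.
Proof.
elim: n F G => [|n IHn] F G eqFG /=; first exact: eqFG.
by congr (_ + _); apply: IHn => u szu; rewrite eqFG //= szu.
Qed.

Lemma sum_words0 (V : nmodType) n : sum_words n (fun=> 0 : V) = 0.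
Proof. by elim: n => //= n ->; rewrite addr0. Qed.

Lemma sum_wordsD (V : nmodType) n (F G : seq bool -> V) :
  sum_words n (fun u => F u + G u) = sum_words n F + sum_words n G.
Proof. by elim: n F G => [|n IHn] F G //=; rewrite !IHn addrACA. Qed.

Lemma raddf_sum_words (V W : nmodType) (f : {additive V -> W}) n F :
  sum_words n (fun u => f (F u)) = f (sum_words n F).
Proof. by elim: n F => [|n IHn] F //=; rewrite !IHn raddfD. Qed.

Lemma mulr_sum_words (S : pzRingType) (a : S) n F :
  a * sum_words n F = sum_words n (fun u => a * F u).
Proof. by elim: n F => [|n IHn] F //=; rewrite mulrDr !IHn. Qed.

Lemma sum_words_cat (V : nmodType) m n (F : seq bool -> V) :
  sum_words (m + n) F =
    sum_words m (fun u => sum_words n (fun v => F (u ++ v))).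
Proof. by elim: m F => [|m IHm] F //=; rewrite !IHm. Qed.

Lemma sum_words_rcons (V : nmodType) n (F : seq bool -> V) :
  sum_words n.+1 F =
    sum_words n (fun u => F (rcons u true) + F (rcons u false)).
Proof.
rewrite -addn1 sum_words_cat; apply: eq_sum_words => u _ /=.
by rewrite !cats1.
Qed.

Lemma sum_words_prefix (V : nmodType) n j (F : seq bool -> V) :
  sum_words n (fun u => F u *+ prefix (nseq j true) u) =
    if (j <= n)%N then sum_words (n - j) (fun v => F (nseq j true ++ v)) else 0.
Proof.
elim: j n F => [|j IHj] [|n] F //=.
rewrite (IHj n (fun u => F (true :: u))).
by rewrite [X in _ + X]sum_words0 addr0.
Qed.

End WordSums.

(** * Words without long blocks of descents *)

Section Avoiders.

(** In a descent word [true] stands for a descent, so a decreasing run of k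
    letters is a block of k - 1 times [true]. *)
Definition avoids (m : nat) (u : seq bool) := ~~ infix (nseq m true) u.

Lemma avoids_cons m b u :
  avoids m (b :: u) = avoids m u && ~~ prefix (nseq m true) (b :: u).
Proof. by rewrite /avoids infix_consl negb_or andbC. Qed.

Lemma prefix_nseq_cons m j u :
  prefix (nseq m true) (nseq j true ++ false :: u) = (m <= j)%N.
Proof. by elim: m j => [|m IHm] [|j] //=; rewrite IHm. Qed.

Lemma avoids_nseq_false m j u : (j < m)%N ->
  avoids m (nseq j true ++ false :: u) = avoids m u.
Proof.
elim: j => [|j IHj] lt_jm.
  by rewrite avoids_cons (prefix_nseq_cons m 0) -ltnNge lt_jm andbT.
rewrite avoids_cons (prefix_nseq_cons m j.+1) -ltnNge lt_jm andbT.
by rewrite IHj // ltnW.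
Qed.

(** After a block one shorter than the forbidden one the next letter is forced
    to be an ascent, and an ascent separates the word into independent parts. *)
Lemma avoids_nseq_cons m b u :
  avoids m.+1 (nseq m true ++ b :: u) = ~~ b && avoids m.+1 u.
Proof.
case: b => /=; last by rewrite avoids_nseq_false.
have -> : nseq m true ++ true :: u = nseq m.+1 true ++ u.
  by rewrite -addn1 nseqD -catA.
by rewrite /avoids prefix_infix.
Qed.

Lemma avoids_nseq m j : (j < m)%N -> avoids m (nseq j true).
Proof.
move=> lt_jm; apply/negP => /size_infix.
by rewrite !size_nseq leqNgt lt_jm.
Qed.

End Avoiders.

(** * The linear recursion for avoiding words *)

Section Operators.
Variable R : numFieldType.
Implicit Types (p q : {poly R}) (u : seq bool).

Definition step b p := if b then fall p else rise p.
(** Applied to 1, this gives the density of the last coordinate of the points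
    with descent word u. *)
Definition run_ops u p := foldl (fun p b => step b p) p u.

Lemma run_ops_is_linear u : linear (run_ops u).
Proof.
elim: u => [|b u IHu] a p q //=.
by rewrite -IHu /step; case: b; rewrite linearP.
Qed.
HB.instance Definition _ u := GRing.isLinear.Build R {poly R} {poly R} *:%R
  (run_ops u) (run_ops_is_linear u).

Lemma run_ops_cat u v p : run_ops (u ++ v) p = run_ops v (run_ops u p).
Proof. by rewrite /run_ops foldl_cat. Qed.

Lemma run_ops_nseq m p : run_ops (nseq m true) p = iter m (@fall R) p.
Proof. by elim: m p => //= m IHm p; rewrite IHm -iterSr. Qed.

Variable m : nat.

(** The volume of the sequences without decreasing run of m + 2 letters that
    start with a letter of density q and go on with n further letters. *)
Definition avoid_int n q : R :=
  sum_words n (fun u => integ01 (run_ops u q) *+ avoids m.+1 u).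

(** The probability that n independent uniform values have no decreasing run of
    m + 2 consecutive letters; the case n = 0 is the empty sequence. *)
Definition avoid_vol n : R := if n is n'.+1 then avoid_int n' 1 else 1.

Lemma avoid_int_is_linear n : linear_for *%R (avoid_int n).
Proof.
move=> a p q; rewrite /avoid_int mulr_sum_words -sum_wordsD.
by apply: eq_sum_words => u _; rewrite !linearP mulrnDl mulrnAr.
Qed.
HB.instance Definition _ n := GRing.isLinear.Build R {poly R} R *%R
  (avoid_int n) (avoid_int_is_linear n).

Lemma avoid_int_rise_fall n q :
  avoid_int n (rise q) + avoid_int n (fall q) = integ01 q * avoid_vol n.+1.
Proof. by rewrite -linearD rise_add_fall -alg_polyC linearZ. Qed.

(** Inclusion and exclusion on the first step. Letting the first step be free
    gives the first term. This overcounts the words in which a run of m + 2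
    letters starts at the beginning and no other run occurs; such a run is
    followed by an ascent, and an ascent is a free step minus a descent. The
    free step gives the second term, and the descent is the same problem with
    m + 2 steps already made downwards. *)
Lemma avoid_int_rec n q :
  avoid_int n q =
    avoid_vol n * integ01 q
    - (if (m.+1 <= n)%N then
         avoid_vol (n - m.+1) * integ01 (iter m.+1 (@fall R) q) else 0)
    + (if (m.+2 <= n)%N then
         avoid_int (n - m.+2) (iter m.+2 (@fall R) q) else 0).
Proof.
case: n => [|n].
  by rewrite /avoid_int /= /avoids mulr1n mul1r subr0 addr0.
have -> : avoid_int n.+1 q = avoid_int n (fall q) + avoid_int n (rise q)
   - sum_words n (fun u => (integ01 (run_ops u (fall q)) *+ avoids m.+1 u)
                           *+ prefix (nseq m true) u).
  apply/eqP; rewrite eq_sym subr_eq eq_sym; apply/eqP.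
rewrite /avoid_int /= addrAC; congr (_ + _).
  rewrite -sum_wordsD; apply: eq_sum_words => u _.
  rewrite avoids_cons /=.
  by case: avoids; case: prefix; rewrite ?mulr1n ?mulr0n ?add0r ?addr0.
rewrite [avoid_int n (fall q) + _]addrC avoid_int_rise_fall.
rewrite sum_words_prefix [integ01 q * _]mulrC -[RHS]addrA; congr (_ + _).
rewrite !ltnS; case: (leqP m n) => [le_mn|lt_nm]; last first.
  by rewrite ltnNge (ltnW lt_nm) /= addr0.
rewrite -[RHS]opprK opprD opprK; congr (- _); rewrite subSS.
case: (ltngtP m n) le_mn => [lt_mn _|//|<- _]; last first.
  rewrite subnn subr0 /= mul1r cats0 avoids_nseq // mulr1n.
  by rewrite run_ops_nseq -iterSr.
rewrite subSS -(subnSK lt_mn) /=.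
rewrite [X in X + _](_ : _ = 0) ?add0r; last first.
  rewrite -[RHS](@sum_words0 _ (n - m.+1)); apply: eq_sum_words => u _.
  by rewrite avoids_nseq_cons mulr0n.
rewrite mulrC -avoid_int_rise_fall addrK.
apply: eq_sum_words => u _; rewrite avoids_nseq_cons /=.
by rewrite run_ops_cat /= run_ops_nseq -iterSr.
Qed.

End Operators.

(** * The alternating expansion *)

Section ClosedForm.

Lemma phi_expSS k i : (0 < k)%N -> phi_exp k i.+2 = (phi_exp k i + k)%N.
Proof.
move=> k_gt0; rewrite /phi_exp /= negbK.
have : (odd i <= uphalf i * k)%N.
  by rewrite uphalf_half mulnDl; case: odd => //=; rewrite mul1n; lia.
by rewrite mulSn => ?; lia.
Qed.

Variables (R : numFieldType) (m : nat).

Definition avoid_term n (q : {poly R}) i : R :=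
  let e := phi_exp m.+2 i in
  if (e <= n)%N then
    (-1) ^+ i * (avoid_vol R m (n - e) * integ01 (iter e (@fall R) q))
  else 0.

(** Unfolding the recursion: each round contributes two terms, whose exponents
    are those of the series [phi]. Since the exponent grows by m + 2 in a
    round, N rounds suffice for n < N * (m + 2). *)
Lemma avoid_int_sum N n q : (n < N * m.+2)%N ->
  avoid_int m n q = \sum_(i < N.*2) avoid_term n q i.
Proof.
elim: N n q => [|N IHN] n q lt_nN; first by rewrite mul0n ltn0 in lt_nN.
have t0 : avoid_term n q 0 = avoid_vol R m n * integ01 q.
  by rewrite /avoid_term (_ : phi_exp m.+2 0 = 0%N) ?subn0 ?expr0 ?mul1r.
have t1 : avoid_term n q 1 = - (if (m.+1 <= n)%N then
    avoid_vol R m (n - m.+1) * integ01 (iter m.+1 (@fall R) q) else 0).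
  rewrite /avoid_term (_ : phi_exp m.+2 1 = m.+1) ?expr1; last first.
    by rewrite /phi_exp mul1n subn1.
  by case: ifP => _; rewrite ?oppr0 // mulN1r.
have tSS i : avoid_term n q i.+2 = if (m.+2 <= n)%N then
    avoid_term (n - m.+2) (iter m.+2 (@fall R) q) i else 0.
  rewrite /avoid_term phi_expSS // !exprS mulrA mulrNN !mul1r -iterD.
  have [le_mn | lt_nm] := leqP m.+2 n; last by rewrite leqNgt ltn_addl.
  by rewrite -subnDA addnC leq_subRL.
rewrite avoid_int_rec -(big_mkord xpredT (avoid_term n q)) doubleS.
rewrite 2?big_nat_recl // t0 t1 addrA; congr (_ + _).
under eq_bigr do rewrite tSS.
have [le_mn | lt_nm] := leqP m.+2 n; last by rewrite big1.
by rewrite big_mkord IHN //; move: lt_nN; rewrite mulSn; lia.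
Qed.

End ClosedForm.

(** * Permutations, descent words and densities *)

Section Permutations.

Lemma perm_at_ord n (w : 'S_n) (i : 'I_n) : perm_at w i.+1 = (w i).+1.
Proof.
rewrite /perm_at (nth_map i) ?size_enum_ord //=.
by congr (w _).+1; apply: val_inj; rewrite /= nth_enum_ord.
Qed.

Lemma perm_at_inord n (w : 'S_n.+1) i : (i <= n)%N ->
  perm_at w i.+1 = (w (inord i)).+1.
Proof. by move=> le_in; rewrite -{1}(@inordK n i) ?perm_at_ord. Qed.

Definition descent_word n (w : 'S_n) : seq bool :=
  mkseq (fun i => perm_at w i.+2 < perm_at w i.+1)%N n.-1.

Lemma size_descent_word n (w : 'S_n) : size (descent_word w) = n.-1.
Proof. by rewrite size_mkseq. Qed.

Lemma sum_lift_perm (V : nmodType) n (i : 'I_n.+1) (F : 'S_n.+1 -> V) :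
  \sum_w F w = \sum_(j < n.+1) \sum_(v : 'S_n) F (lift_perm i j v).
Proof.
pose f (p : 'I_n.+1 * 'S_n) := lift_perm i p.1 p.2.
have f_inj : injective f.
  move=> [j v] [j' v'] /permP eq_f.
  have eq_j : j = j' by have := eq_f i; rewrite /f /= !lift_perm_id.
  rewrite -eq_j in eq_f *; congr (_, _); apply/permP => k.
  have := eq_f (lift i k); rewrite /f /= !lift_perm_lift.
  exact: lift_inj.
(* there are (n+1) * n! pairs and (n+1)! permutations *)
have f_bij : bijective f.
  by apply: inj_card_bij => //; rewrite card_prod card_ord !card_Sn factS.
rewrite pair_big (reindex f) //=; exact: onW_bij.
Qed.

Lemma perm_at_lift n (v : 'S_n.+1) (j : 'I_n.+2) i : (i <= n)%N ->
  perm_at (lift_perm ord_max j v) i.+1 = (bump j (v (inord i))).+1.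
Proof.
move=> le_in.
have -> : i.+1 = (lift ord_max (inord i : 'I_n.+1)).+1.
  by rewrite lift_max inordK.
by rewrite perm_at_ord lift_perm_lift.
Qed.

Lemma perm_at_lift_max n (v : 'S_n.+1) (j : 'I_n.+2) :
  perm_at (lift_perm ord_max j v) n.+2 = j.+1.
Proof. by rewrite -[n.+2]/(ord_max : 'I_n.+2).+1 perm_at_ord lift_perm_id. Qed.

(** Only the comparison of the new last letter j with the old one matters. The
    old last letter v is bumped to v + 1 exactly when j <= v, so j <= v is
    equivalent to a final descent. *)
Lemma descent_word_lift n (v : 'S_n.+1) (j : 'I_n.+2) :
  descent_word (lift_perm ord_max j v) =
    rcons (descent_word v) (j <= v ord_max)%N.
Proof.
apply: (@eq_from_nth _ false) => [|i].
  by rewrite size_rcons !size_descent_word.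
rewrite size_descent_word /= ltnS => le_in.
rewrite nth_rcons size_descent_word /= nth_mkseq //=.
rewrite [perm_at _ i.+1]perm_at_lift //.
have [lt_in|le_ni] := ltnP i n; last first.
  have {le_in le_ni} -> : i = n by lia.
  rewrite eqxx perm_at_lift_max ltnS.
  have -> : inord n = ord_max :> 'I_n.+1 by apply: val_inj; rewrite /= inordK.
  by rewrite /bump; case: leqP; lia.
rewrite perm_at_lift // nth_mkseq // !perm_at_inord //.
by rewrite ltnS [RHS]ltnS !ltnNge leq_bump2.
Qed.

Variable R : numFieldType.

(** The bridge between counting and integration. Appending a letter to all
    permutations at once turns the density at the last letter into its [fall]
    or its [rise], so by induction the permutations with a given descent word
    have total density [run_ops u 1]. *)
Lemma sum_perm_words n (G : seq bool -> bool) :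
  \sum_(w : 'S_n.+1) bernpoly R n (w ord_max) *+ G (descent_word w) =
    sum_words n (fun u => run_ops u 1 *+ G u).
Proof.
elim: n G => [|n IHn] G.
  rewrite (sum_lift_perm ord0) big_ord1.
  rewrite (eq_bigr (fun=> 1%:P *+ G [::])) => [|w _].
    by rewrite sumr_const card_Sn.
  rewrite (size0nil (size_descent_word (lift_perm _ _ w))) ord1 /bernpoly.
  by rewrite /divpow !expr0 fact0 invr1 !scale1r comp_polyC mulr1.
rewrite sum_words_rcons (sum_lift_perm ord_max) exchange_big /=.
rewrite (eq_bigr (fun v : 'S_n.+1 =>
    fall (bernpoly R n (v ord_max)) *+ G (rcons (descent_word v) true)
  + rise (bernpoly R n (v ord_max)) *+ G (rcons (descent_word v) false))).
  rewrite big_split /= sum_wordsD; congr (_ + _).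
    under eq_bigr do rewrite -linearMn.
    rewrite -linear_sum (IHn (fun u => G (rcons u true))) /=.
    rewrite -raddf_sum_words; apply: eq_sum_words => u _.
    by rewrite raddfMn /run_ops foldl_rcons.
  under eq_bigr do rewrite -linearMn.
  rewrite -linear_sum (IHn (fun u => G (rcons u false))) /=.
  rewrite -raddf_sum_words; apply: eq_sum_words => u _.
  by rewrite raddfMn /run_ops foldl_rcons.
move=> v _; set a := v ord_max.
have le_an : (a <= n)%N by rewrite -ltnS.
rewrite rise_bernpoly // fall_bernpoly //.
under eq_bigr do rewrite lift_perm_id descent_word_lift -/a.
rewrite -(big_mkord xpredT (fun j => bernpoly R n.+1 j *+
  G (rcons (descent_word v) (j <= a)%N))).
rewrite (big_cat_nat (n := a.+1)) //=; last by rewrite ltnW.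
rewrite -!sumrMnl; congr (_ + _); apply: eq_big_nat => j.
  by rewrite ltnS => /andP[_ ->].
by case/andP=> lt_aj _; rewrite leqNgt lt_aj.
Qed.

End Permutations.

(** * Decreasing runs read off the descent word *)

Section WordRuns.
Implicit Types (u v : seq bool) (I J : {fset nat}).

Definition run_at m u i := all (nth false u) (iota i m).

Lemma run_atP m u i :
  reflect (forall j, (j < m)%N -> nth false u (i + j)) (run_at m u i).
Proof.
apply: (iffP allP) => [H j lt_jm | H x].
  by apply: H; rewrite mem_iota leq_addr ltn_add2l.
rewrite mem_iota => /andP[le_ix lt_x].
by rewrite -(subnKC le_ix); apply: H; rewrite ltn_subLR.
Qed.

Lemma run_at_size m u i : (0 < m)%N -> run_at m u i -> (i + m <= size u)%N.
Proof.
case: m => // m _ /run_atP/(_ m (ltnSn m)); rewrite addnS.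
by case: ltnP => // le_u; rewrite nth_default.
Qed.

Lemma run_at_cons m b u i : run_at m (b :: u) i.+1 = run_at m u i.
Proof. by rewrite /run_at -(addn1 i) addnC iotaDl all_map. Qed.

Lemma run_at0 m u : run_at m u 0 = prefix (nseq m true) u.
Proof.
elim: m u => [|m IHm] [|b u] //=.
by rewrite -IHm -(run_at_cons m b); case: b.
Qed.

Lemma infix_nseqP m u : (0 < m)%N ->
  reflect (exists i, run_at m u i) (infix (nseq m true) u).
Proof.
move=> m_gt0; elim: u => [|b u IHu].
  rewrite infixs0; case: m m_gt0 => // m _; constructor=> -[i].
  by move/run_at_size => /(_ isT) /=; rewrite addnS.
rewrite infix_consl -run_at0; apply: (iffP orP) => [[|/IHu[i]]|[[|i]]].
- by exists 0%N.
- by exists i.+1; rewrite run_at_cons.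
- by left.
- by rewrite run_at_cons => ui; right; apply/IHu; exists i.
Qed.

(** The positions are counted from 1, as in [descent_runs], while the letters of
    the word are counted from 0. *)
Definition word_runs k u : {fset nat} :=
  [fset i in iota 1 (size u) | run_at k.-1 u i.-1]%fset.

Lemma in_word_runs k u i : (1 < k)%N ->
  (i \in word_runs k u) = (0 < i)%N && run_at k.-1 u i.-1.
Proof.
move=> k_gt1; rewrite !inE /= mem_iota.
have [|_] := posnP i; first by move->.
rewrite /= andb_idl // => /run_at_size.
by case: i k k_gt1 => [|i] [|[|k]] //= _ /(_ isT); lia.
Qed.

Lemma word_runs_eq0 k u : (1 < k)%N ->
  (word_runs k u == fset0) = avoids k.-1 u.
Proof.
move=> k_gt1; have k1_gt0 : (0 < k.-1)%N by case: k k_gt1 => [|[]].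
apply/eqP/negP => [u0 /(infix_nseqP _ k1_gt0)[i ui] | nu].
  have : i.+1 \in word_runs k u by rewrite in_word_runs.
  by rewrite u0.
apply/fsetP => i; rewrite in_word_runs // inE; apply/negP => /andP[_ ui].
by apply: nu; apply/(infix_nseqP _ k1_gt0); exists i.-1.
Qed.

Lemma bigmax_mem (s : seq nat) i : i \in s -> \max_(j <- s) j \in s.
Proof.
elim: s i => // a s IHs i _; rewrite big_cons inE.
case: s IHs => [_|b s IHs]; first by rewrite big_nil maxn0 eqxx.
have /IHs max_s : b \in b :: s by rewrite mem_head.
by case: leqP => _; rewrite ?eqxx // max_s orbT.
Qed.

(** The last run, at M = max I, covers the last k letters before b. If b were a
    descent there would also be a run at M + 1, so b is an ascent; no run can
    cross an ascent, hence all runs in I lie before it and none lies after. *)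
Lemma word_runs_cat k I u b v :
  (1 < k)%N -> I != fset0 -> 0%N \notin I ->
  (size u).+1 = (\max_(i <- I) i + k - 1)%N ->
  (word_runs k (u ++ b :: v) == I) =
    [&& word_runs k u == I, ~~ b & avoids k.-1 v].
Proof.
move=> k_gt1 /fset0Pn[i0 Ii0] I0; set M := \max_(i <- I) i => szu.
have leM i : i \in I -> (i <= M)%N by move=> Ii; apply: leq_bigmax_seq.
have IM : M \in I.
  exact: bigmax_mem Ii0.
have M_gt0 : (0 < M)%N by rewrite lt0n; apply: contraNneq I0 => <-.
have k1_gt0 : (0 < k.-1)%N by lia.
have nthU x : nth false (u ++ b :: v) x =
    if (x < size u)%N then nth false u x
    else if x == size u then b else nth false v (x - (size u).+1).
  rewrite nth_cat; case: ltnP => // le_ux; case: eqP => [->|neq_xu].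
    by rewrite subnn.
  by rewrite (_ : x - size u = (x - (size u).+1).+1)%N //; lia.
have nthu x : nth false u x -> (x < size u)%N.
  by case: ltnP => // le_ux; rewrite nth_default.
apply/eqP/and3P => [defI | [/eqP defI nb nv]].
  have Irun i : (i \in I) = (0 < i)%N && run_at k.-1 (u ++ b :: v) i.-1.
    by rewrite -defI in_word_runs.
  have := IM; rewrite Irun => /andP[_ /run_atP runM].
  split.
  - apply/eqP/fsetP => i; rewrite in_word_runs //; apply/idP/idP.
      case/andP=> i_gt0 /run_atP ui; rewrite Irun i_gt0.
      apply/run_atP => j lt_j.
      by rewrite nthU nthu ui.
    move=> Ii; have := leM i Ii; rewrite Irun in Ii.
    case/andP: Ii => i_gt0 /run_atP ui le_iM; rewrite i_gt0 /=.
    apply/run_atP => j lt_j; have := ui j lt_j; rewrite nthU ifT //; lia.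
  - apply/negP => b1; suff /leM : M.+1 \in I by rewrite ltnn.
    rewrite Irun; apply/run_atP => j lt_j; rewrite /=.
    have [lt_jk|le_kj] := ltnP j.+1 k.-1.
      have := runM j.+1 lt_jk.
      by rewrite (_ : M.-1 + j.+1 = M + j)%N //; lia.
    by rewrite nthU ifF ?ifT //; lia.
  - apply/negP => /(infix_nseqP _ k1_gt0)[j /run_atP vj].
    suff /leM : ((size u).+1 + j).+1 \in I by lia.
    rewrite Irun; apply/run_atP => x lt_x; rewrite nthU !ifF; [|lia..].
    by rewrite (_ : _ - _ = j + x)%N ?vj //; lia.
apply/fsetP => i; rewrite -defI !in_word_runs //.
case: posnP => //= i_gt0; apply/run_atP/run_atP => run_i j lt_j.
  have [le_iM|lt_Mi] := leqP i M.
    by have := run_i j lt_j; rewrite nthU ifT //; lia.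
  have [le_iu|lt_ui] := leqP i.-1 (size u).
    (* the window would contain the position of the ascent b *)
    have lt_d : (size u - i.-1 < k.-1)%N by lia.
    by have := run_i _ lt_d; rewrite subnKC // nthU ltnn eqxx (negPf nb).
  case/negP: nv; apply/(infix_nseqP _ k1_gt0); exists (i.-1 - (size u).+1)%N.
  apply/run_atP => x lt_x; have := run_i x lt_x; rewrite nthU !ifF; [|lia..].
  by rewrite (_ : _ - _ + x = i.-1 + x - (size u).+1)%N //; lia.
by rewrite nthU nthu run_i.
Qed.

Lemma run_at_rev m u i : (i + m <= size u)%N ->
  run_at m (rev u) i = run_at m u (size u - m - i).
Proof.
move=> le_im; apply/run_atP/run_atP => H j lt_jm.
  have := H (m - j.+1)%N; rewrite nth_rev; last by lia.
  have -> : (size u - (i + (m - j.+1)).+1 = size u - m - i + j)%N by lia.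
  by apply; lia.
rewrite nth_rev; last by lia.
have := H (m - j.+1)%N.
have -> : (size u - m - i + (m - j.+1) = size u - (i + j).+1)%N by lia.
by apply; lia.
Qed.

Lemma word_runs_rev k u : (1 < k)%N ->
  word_runs k (rev u) = reflect_runs k (size u).+1 (word_runs k u).
Proof.
move=> k_gt1; have k1_gt0 : (0 < k.-1)%N by lia.
apply/fsetP => i; rewrite in_word_runs // /reflect_runs.
apply/idP/imfsetP => /=.
  case/andP=> i_gt0 ri; have := run_at_size k1_gt0 ri; rewrite size_rev => le_i.
  exists ((size u).+1 + 2 - k - i)%N; last by lia.
  rewrite in_word_runs //; apply/andP; split; first by lia.
  rewrite (_ : (_ - i).-1 = size u - k.-1 - i.-1)%N; last by lia.
  by rewrite -run_at_rev.
case=> j; rewrite in_word_runs // => /andP[j_gt0 uj] ->.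
have le_j := run_at_size k1_gt0 uj.
apply/andP; split; first by lia.
rewrite run_at_rev; last by lia.
by rewrite (_ : size u - _ - _ = j.-1)%N //; lia.
Qed.

Lemma reflect_runsK k t J :
  (forall i, i \in J -> i + k <= t + 2)%N ->
  reflect_runs k t (reflect_runs k t J) = J.
Proof.
move=> leJ; apply/fsetP => i; apply/imfsetP/idP => /=.
  case=> j /imfsetP[l /= Jl ->] ->; have := leJ l Jl => ?.
  by rewrite (_ : _ - _ = l)%N //; lia.
move=> Ji; have := leJ i Ji => ?; exists (t + 2 - k - i)%N; last by lia.
by apply/imfsetP; exists i.
Qed.

Lemma descent_runs_word k n (w : 'S_n) : (1 < k)%N ->
  descent_runs k w = word_runs k (descent_word w).
Proof.
move=> k_gt1; apply/fsetP => i; rewrite in_word_runs // !inE /= mem_iota.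
case: posnP => //= i_gt0; have eS j : (i.-1 + j).+1 = (i + j)%N.
  by rewrite -addSn prednK.
apply/andP/run_atP => [[lt_i /forallP wi] j lt_j | wi].
  have := wi (Ordinal lt_j); rewrite nth_mkseq ?eS ?addnS //.
  by lia.
have /(run_at_size _) : run_at k.-1 (descent_word w) i.-1 by apply/run_atP.
rewrite size_descent_word => le_i; split; first by lia.
apply/forallP => j; have := wi j (ltn_ord j).
rewrite nth_mkseq ?eS ?addnS //.
by have := ltn_ord j; lia.
Qed.

End WordRuns.

(** * Counting permutations by integrals *)

Section Counting.
Variable R : realType.
Implicit Types (I J : {fset nat}).

(** The density of the last letter among the permutations of n + 1 letters with
    run set J, by [runs_polyE]. *)
Definition runs_poly k J n : {poly R} :=
  sum_words n (fun u => run_ops u 1 *+ (word_runs k u == J)).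

Lemma runs_polyE k J n : (1 < k)%N ->
  runs_poly k J n =
    \sum_(w : 'S_n.+1 | descent_runs k w == J) bernpoly R n (w ord_max).
Proof.
move=> k_gt1; rewrite /runs_poly -(sum_perm_words _ _ (fun u => _ == J)).
rewrite [RHS]big_mkcond /=.
by apply: eq_bigr => w _; rewrite descent_runs_word // mulrb.
Qed.

Lemma num_runs_integ01 k J n : (1 < k)%N ->
  (num_runs k J n.+1)%:R = (n.+1)`!%:R * integ01 (runs_poly k J n).
Proof.
move=> k_gt1; rewrite runs_polyE // linear_sum mulr_sumr /=.
rewrite /num_runs -sum1_card.
rewrite natr_sum; apply: eq_big => [w|w _]; first by rewrite inE.
rewrite integ01_bernpoly; last by rewrite -ltnS.
by rewrite divff // pnatr_eq0 -lt0n fact_gt0.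
Qed.

Lemma avoid_volE m n : avoid_vol R m n = (num_avoid m.+2 n)%:R / n`!%:R.
Proof.
case: n => [|n].
  rewrite /= /num_avoid /num_runs (eq_card (B := predT)).
    by rewrite card_Sn fact0 divff.
  by move=> w; rewrite !inE descent_runs_word // word_runs_eq0.
rewrite /num_avoid num_runs_integ01 // mulrC.
rewrite mulKf ?pnatr_eq0 -?lt0n ?fact_gt0 //.
rewrite /runs_poly -raddf_sum_words; apply: eq_sum_words => u _.
by rewrite raddfMn word_runs_eq0.
Qed.

(** A permutation with run set I is a prefix of length t + 1 with run set I, an
    ascent, and an avoiding continuation. *)
Lemma num_runs_avoid_int m I t n : I != fset0 -> 0%N \notin I ->
  t.+1 = (\max_(i <- I) i + m.+2 - 1)%N ->
  (num_runs m.+2 I (t.+1 + n.+1))%:R =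
    (t.+1 + n.+1)`!%:R * avoid_int m n (rise (runs_poly m.+2 I t)).
Proof.
move=> I_neq0 I0 def_t; rewrite addnS num_runs_integ01 //; congr (_ * _).
rewrite /runs_poly addSnnS sum_words_cat -!raddf_sum_words.
apply: eq_sum_words => u szu.
have cat_runs b v : (word_runs m.+2 (u ++ b :: v) == I) =
    [&& word_runs m.+2 u == I, ~~ b & avoids m.+1 v].
  by rewrite word_runs_cat // szu.
rewrite /= [X in X + _](_ : _ = 0); last first.
  rewrite -[RHS](@sum_words0 {poly R} n); apply: eq_sum_words => v _.
  by rewrite cat_runs andbF.
rewrite add0r !raddfMn /= -raddf_sum_words /avoid_int.
case: (word_runs m.+2 u == I) cat_runs => cat_runs; last first.
  rewrite mulr0n -[RHS](@sum_words0 R n); apply: eq_sum_words => v _.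
  by rewrite cat_runs raddf0.
by apply: eq_sum_words => v _; rewrite cat_runs raddfMn run_ops_cat.
Qed.

(** Descents are kept, their order is reversed, and the last letter becomes the
    first. *)
Definition rev_compl n (w : 'S_n) : 'S_n :=
  perm (inj_comp rev_ord_inj (inj_comp (@perm_inj _ w) rev_ord_inj)).

Lemma rev_complK n : involutive (@rev_compl n).
Proof.
by move=> w; apply/permP => i; rewrite !permE /= !permE /= !rev_ordK.
Qed.

Lemma perm_at_rev_compl n (w : 'S_n.+1) i : (i <= n)%N ->
  perm_at (rev_compl w) i.+1 = (n.+1 - w (inord (n - i)))%N.
Proof.
move=> le_in; rewrite perm_at_inord // permE /= subnSK //.
by congr (_ - w _)%N; apply: val_inj; rewrite /= !inordK // ltnS leq_subr.
Qed.

Lemma descent_word_rev_compl n (w : 'S_n.+1) :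
  descent_word (rev_compl w) = rev (descent_word w).
Proof.
apply: (@eq_from_nth _ false) => [|i].
  by rewrite size_rev !size_descent_word.
rewrite size_descent_word /= => lt_in.
rewrite nth_rev size_descent_word //= !nth_mkseq //=; last by lia.
rewrite !perm_at_rev_compl; [|lia..]. rewrite !perm_at_inord; [|lia..].
rewrite subnSK //; have := ltn_ord (w (inord (n - i))).
by have := ltn_ord (w (inord (n - i.+1))); lia.
Qed.

Lemma num_runs_first_rev_compl k n I s :
  (1 < k)%N -> (forall i, i \in I -> i + k <= n.+1 + 2)%N -> (s <= n)%N ->
  num_runs_first k (reflect_runs k n.+1 I) (n.+1 - s) n.+1 =
    #|[pred w : 'S_n.+1 | (descent_runs k w == I) && (w ord_max == s :> nat)]|.
Proof.
move=> k_gt1 leI le_sn; rewrite /num_runs_first -!sum1_card.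
rewrite (reindex_inj (inv_inj (@rev_complK n.+1))); apply: eq_bigl => w.
rewrite !inE; congr (_ && _).
  rewrite !descent_runs_word // descent_word_rev_compl word_runs_rev //.
  rewrite size_descent_word; apply/eqP/eqP => [eq_r | -> //].
  rewrite -(@reflect_runsK k n.+1 I leI) -eq_r reflect_runsK // => i.
  rewrite in_word_runs // => /andP[i_gt0 /run_at_size].
  by rewrite size_descent_word /=; lia.
rewrite perm_at_rev_compl // subn0 (_ : inord n = ord_max); last first.
  by apply: val_inj; rewrite /= inordK.
by have := ltn_ord (w ord_max); lia.
Qed.

(** Grouping the permutations in [runs_poly] by their last letter, which the
    reverse complement turns into a first letter. *)
Lemma sum_order_density k n I (y : R) :
  (1 < k)%N -> (forall i, i \in I -> i + k <= n.+1 + 2)%N ->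
  \sum_(1 <= s < n.+2)
    (num_runs_first k (reflect_runs k n.+1 I) (n.+1 + 1 - s) n.+1)%:R
      * order_density n.+1 s y =
  (n.+1)`!%:R * (runs_poly k I n).[y].
Proof.
move=> k_gt1 leI; rewrite runs_polyE //.
rewrite (partition_big (fun w : 'S_n.+1 => w ord_max) predT) //=.
rewrite horner_sum mulr_sumr big_add1 /= big_mkord; apply: eq_bigr => s _.
have le_sn : (s <= n)%N by rewrite -ltnS.
rewrite addn1 subSS num_runs_first_rev_compl //.
rewrite (eq_bigr (fun=> bernpoly R n s)) => [|w /andP[_ /eqP-> //]].
rewrite (eq_bigl [in [pred w : 'S_n.+1 |
  (descent_runs k w == I) && (w ord_max == s :> nat)]]) => [|w //].
rewrite sumr_const hornerMn horner_bernpoly // /order_density subSS /=.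
rewrite -[_ *+ _ in RHS]mulr_natr; ring.
Qed.

End Counting.

(** * Integrals and limits *)

Section Analysis.
Variable R : realType.
Implicit Types (p q : {poly R}).

Lemma Rintegral_horner p (a b : R) : a <= b ->
  \int[lebesgue_measure]_(x in `[a, b]) p.[x] =
    (antideriv p).[b] - (antideriv p).[a].
Proof.
rewrite le_eqVlt => /predU1P[<-|lt_ab].
  by rewrite set_itv1 Rintegral_set1 subrr.
rewrite /Rintegral (@continuous_FTC2 _ _ (horner (antideriv p))) //.
- by apply: continuous_subspaceT => x; exact: continuous_horner.
- split=> [x _||].
  + exact: derivable_horner.
  + by apply: cvg_at_right_filter; exact: continuous_horner.
  + by apply: cvg_at_left_filter; exact: continuous_horner.
- by move=> x _; rewrite -derivE deriv_antideriv.
Qed.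

(** A bound for the polynomial on the unit interval. *)
Definition coef_norm p : R := \sum_(i < size p) `|p`_i|.

Lemma coef_norm_ge0 p : 0 <= coef_norm p.
Proof. exact: sumr_ge0. Qed.

Lemma horner_coef_norm p x : 0 <= x <= 1 -> `|p.[x]| <= coef_norm p.
Proof.
case/andP=> x0 x1; rewrite horner_coef.
apply: le_trans (ler_norm_sum _ _ _) _; apply: ler_sum => i _.
by rewrite normrM ler_piMr // normrX ger0_norm // exprn_ile1.
Qed.

Lemma phi_exp_ge k i : (1 < k)%N -> (i <= phi_exp k i)%N.
Proof.
move=> k_gt1; elim/ltn_ind: i => -[|[|i]] IHi //.
  by rewrite /phi_exp /= mul1n; lia.
by rewrite phi_expSS ?(ltnW k_gt1) //; have := IHi i; lia.
Qed.

Lemma cvg_seq_bound (u : nat -> R) (l : R) :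
  u @ \oo --> l -> exists2 M, 0 <= M & forall n, `|u n| <= M.
Proof.
move=> /cvgP/cvg_seq_bounded[M [_ HM]]; exists (`|M| + 1).
  by rewrite addr_ge0.
move=> n; have := HM (`|M| + 1); rewrite (le_lt_trans (ler_norm _)) ?ltrDl //.
by move=> /(_ isT n I).
Qed.

(** The terms of the exponential series of 2|a| are bounded. *)
Lemma exp_fact_bound (a : R) :
  exists2 M : R, 0 <= M & forall e, `|a| ^+ e / e`!%:R <= M / 2 ^+ e.
Proof.
have [M M0 HM] := cvg_seq_bound (cvg_exp_coeff (2 * `|a|)).
exists M => // e; have := HM e; rewrite exp_coeffE ger0_norm; last first.
  by rewrite mulr_ge0 ?invr_ge0 ?ler0n ?exprn_ge0 ?mulr_ge0.
rewrite ler_pdivlMr ?exprn_gt0 //; congr (_ <= _).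
by rewrite exprMn; ring.
Qed.

Lemma geometric_half_sum N : \sum_(i < N) (2^-1 : R) ^+ i <= 2.
Proof.
have -> : \sum_(i < N) (2^-1 : R) ^+ i = 2 - 2 * 2^-1 ^+ N.
  elim: N => [|N IHN]; first by rewrite big_ord0 expr0; lra.
  by rewrite big_ord_recr /= IHN exprS; lra.
by rewrite gerBl mulr_ge0 ?exprn_ge0 ?invr_ge0.
Qed.

Lemma geometric_tail (w : nat -> R) M N N' : (N <= N')%N ->
  (forall i, `|w i| <= M * 2^-1 ^+ i) ->
  `|\sum_(i < N') w i - \sum_(i < N) w i| <= M * 2 * 2^-1 ^+ N.
Proof.
move=> le_N wM.
have M0 : 0 <= M by have := wM 0%N; rewrite expr0 mulr1; apply: le_trans.
rewrite -!(big_mkord xpredT w) (big_cat_nat (n := N)) //= addrAC subrr add0r.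
apply: le_trans (ler_norm_sum _ _ _) _.
rewrite -{1}[N]add0n big_addn big_mkord.
apply: (@le_trans _ _ (\sum_(i < N' - N) (M * 2^-1 ^+ N) * 2^-1 ^+ i)).
  by apply: ler_sum => i _; rewrite -mulrA -exprD addnC.
rewrite -mulr_sumr [leRHS]mulrAC ler_wpM2l ?geometric_half_sum //.
by rewrite mulr_ge0 ?exprn_ge0 ?invr_ge0.
Qed.

(** Tannery's theorem under a geometric bound. Since the limit l of the finite
    sums is given, one passes to the limit in n for a fixed truncation N, and
    the distance to l is at most a geometric tail. *)
Lemma tannery (u : nat -> nat -> R) (v x : nat -> R) (l M : R) :
  (forall n i, `|u n i| <= M * 2^-1 ^+ i) ->
  (forall i, u ^~ i @ \oo --> v i) ->
  (forall n N0, exists2 N, (N0 <= N)%N & x n = \sum_(i < N) u n i) ->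
  x @ \oo --> l ->
  (fun N => \sum_(i < N) v i) @ \oo --> l.
Proof.
move=> uM uv xu xl.
have bound N : `|\sum_(i < N) v i - l| <= M * 2 * 2^-1 ^+ N.
  have cvg_u : (fun n => \sum_(i < N) u n i) @ \oo --> \sum_(i < N) v i.
    elim: N => [|N IHN].
      by rewrite big_ord0; under eq_fun do rewrite big_ord0; exact: cvg_cst.
    rewrite big_ord_recr; under eq_fun do rewrite big_ord_recr.
    exact: cvgD.
  apply: (ler_cvg_to (cvg_norm (cvgB cvg_u xl)) (cvg_cst _)).
  apply: nearW => n /=; have [N' le_N xnE] := xu n N.
  rewrite [_ n](_ : _ = \sum_(i < N) u n i - x n) // xnE.
  by rewrite distrC; apply: geometric_tail.
apply/(subr_cvg0 (fun N => \sum_(i < N) v i) l); apply: norm_cvg0.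
have tail0 : (fun N => M * 2 * 2^-1 ^+ N) @ \oo --> (0 : R).
  rewrite -[0](mulr0 (M * 2)); apply: cvgM; first exact: cvg_cst.
  by apply: cvg_expr; rewrite ger0_norm ?invr_ge0 // invf_lt1 // ltr1n.
apply: squeeze_cvgr (cvg_cst 0) tail0.
by apply: nearW => N; rewrite normr_ge0 bound.
Qed.

Lemma eqO_cvg0 (e g : nat -> R) : e =O_\oo g -> g @ \oo --> 0 -> e @ \oo --> 0.
Proof.
move=> /eqO_exP[C _ eC] g0; apply: norm_cvg0.
have Cg0 : (fun n => C * `|g n|) @ \oo --> (0 : R).
  rewrite -[0](mulr0 C) -(@normr0 _ R).
  by apply: cvgM; [exact: cvg_cst | exact: cvg_norm].
apply: squeeze_cvgr (cvg_cst 0) Cg0.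
by near=> n; rewrite normr_ge0 /=; near: n.
Unshelve. all: by end_near. Qed.

(** n^(-a) < e as soon as n > e^(-1/a). *)
Lemma powR_cvg0 (a : R) : 0 < a -> (fun n => n%:R `^ (- a)) @ \oo --> (0 : R).
Proof.
move=> a0; apply/cvgrPdist_lt => e e0.
near=> n.
have n0 : 0 < n%:R :> R by near: n; exact: nbhs_infty_gtr.
have lt_en : e `^ (- a^-1) < n%:R by near: n; exact: nbhs_infty_gtr.
rewrite sub0r normrN ger0_norm ?powR_ge0 // powRN.
rewrite -[ltRHS]invrK ltf_pV2 ?posrE ?invr_gt0 ?powR_gt0 //.
have := @gt0_ltr_powR _ a a0 (e `^ (- a^-1)) n%:R.
rewrite !nnegrE powR_ge0 ler0n => /(_ isT isT lt_en).
by rewrite -powRrM mulNr mulVf ?gt_eqF // powRN powRr1 // ltW.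
Unshelve. all: by end_near. Qed.

End Analysis.

(** * The limiting constant *)

Section Limits.
Variable R : realType.
Implicit Types (q : {poly R}) (r c C l : R).

Lemma near_eq_cvgn (u v : nat -> R) (l : R) :
  (\forall n \near \oo, u n = v n) -> u @ \oo --> l -> v @ \oo --> l.
Proof. by move=> uv; apply: cvg_trans; exact: near_eq_cvg. Qed.

(** The exponents satisfy [i <= phi_exp k i], so the terms of the series decay
    at least like 2^(-i), uniformly for b bounded by a. *)
Lemma phi_exp_bound (a : R) : exists2 M : R, 0 <= M & forall k (b : R) i,
  (1 < k)%N -> `|b| <= `|a| ->
  `|b| ^+ phi_exp k i / (phi_exp k i)`!%:R <= M * 2^-1 ^+ i.
Proof.
have [M M0 aM] := exp_fact_bound a; exists M => // k b i k_gt1 le_ba.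
apply: (@le_trans _ _ (M * 2^-1 ^+ phi_exp k i)); last first.
  rewrite ler_wpM2l // ler_wiXn2l ?invr_ge0 ?invf_le1 ?ler1n //.
  exact: phi_exp_ge.
rewrite exprVn; apply: le_trans (aM _).
by rewrite ler_wpM2r ?invr_ge0 ?ler0n // lerXn2r ?nnegrE.
Qed.

(** The series [phi] is integrated term by term against q: the partial sums are
    polynomials, dominated on the unit interval by a constant. *)
Lemma cvg_phi_integral k r q : (1 < k)%N -> 0 < r ->
  (fun N => \sum_(i < N) (-1) ^+ i * r^-1 ^+ phi_exp k i
                         * integ01 (divpow R (phi_exp k i) * q)) @ \oo -->
  r * \int[lebesgue_measure]_(x in `[0, 1]) (phi k r x * q.[x]).
Proof.
move=> k_gt1 r0; pose e := phi_exp k.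
pose a x i := (-1) ^+ i * (x / r) ^+ e i / (e i)`!%:R.
pose S N := r^-1 *:
  \sum_(i < N) ((-1) ^+ i * r^-1 ^+ e i) *: (divpow R (e i) * q).
have S_horner N x : (S N).[x] = r^-1 * (\sum_(i < N) a x i) * q.[x].
  rewrite /S hornerZ horner_sum -mulrA mulr_suml; congr (_ * _).
  apply: eq_bigr => i _; rewrite hornerZ hornerM horner_divpow /a exprMn.
  by ring.
have [M M0 aM] := phi_exp_bound r^-1.
have a_bound x i : 0 <= x <= 1 -> `|a x i| <= M * 2^-1 ^+ i.
  case/andP=> x0 x1; rewrite /a 2!normrM normrX normrN1 expr1n mul1r normrX.
  rewrite [X in _ * X]ger0_norm ?invr_ge0 ?ler0n //; apply: aM => //.
  by rewrite normrM ler_piMl // ger0_norm.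
have a_cvg x : 0 <= x <= 1 -> cvgn (series (a x)).
  move=> x01; apply: normed_cvg.
  apply: (@series_le_cvg _ _ (geometric M 2^-1)) => /= [n|n|n|].
  - exact: normr_ge0.
  - by rewrite mulr_ge0 ?exprn_ge0 ?invr_ge0.
  - exact: a_bound.
  apply: is_cvg_geometric_series.
  by rewrite ger0_norm ?invr_ge0 // invf_lt1 // ltr1n.
have S_cvg x : 0 <= x <= 1 -> (S N).[x] @[N --> \oo] --> phi k r x * q.[x].
  move=> x01; under eq_fun do rewrite S_horner.
  apply: cvgM; last exact: cvg_cst.
  apply: cvgM; first exact: cvg_cst.
  have := a_cvg x x01; rewrite /series /=.
  by under eq_fun do rewrite big_mkord.
have S_bound N x : 0 <= x <= 1 -> `|(S N).[x]| <= r^-1 * (M * 2) * coef_norm q.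
  move=> x01; rewrite S_horner normrM ler_pM //; last exact: horner_coef_norm.
  have ri0 : 0 < r^-1 by rewrite invr_gt0.
  rewrite normrM (gtr0_norm ri0) ler_pM2l //.
  apply: le_trans (ler_norm_sum _ _ _) _.
  apply: (@le_trans _ _ (\sum_(i < N) M * 2^-1 ^+ i)).
    by apply: ler_sum => i _; exact: a_bound.
  by rewrite -mulr_sumr ler_wpM2l // geometric_half_sum.
pose D : set (measurableTypeR R) := `[0, 1]%classic.
have mS N : measurable_fun D (fun x : R => ((S N).[x])%:E : \bar R).
  by apply/measurable_EFinP; exact: measurable_poly.
have in01 (x : R) : D x -> 0 <= x <= 1 by rewrite /D /= in_itv.
have S_cvgE (x : R) : D x ->
    (((S N).[x])%:E @[N --> \oo] --> (phi k r x * q.[x])%:E)%E.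
  by move=> /in01 x01; apply: cvg_EFin; [exact: nearW | exact: S_cvg].
have [||||phi_int _ int_cvg] := @dominated_convergence _ _ R lebesgue_measure
  D (measurable_itv _) (fun N (x : R) => ((S N).[x])%:E : \bar R)
  (fun x : R => (phi k r x * q.[x])%:E : \bar R)
  (cst (r^-1 * (M * 2) * coef_norm q)%:E) mS.
- exact: (emeasurable_fun_cvg _ _ mS S_cvgE).
- by apply: aeW => x; exact: S_cvgE.
- apply: (@continuous_compact_integrable R (cst _)).
    exact: segment_compact.
  by apply: continuous_subspaceT => x; exact: cvg_cst.
- by apply: aeW => x N x01; rewrite lee_fin S_bound // in01.
have int_fin := integrable_fin_num (measurable_itv _ : measurable D) phi_int.
rewrite -(fineK int_fin) in int_cvg.
have {}int_cvg : (fun N => \int[lebesgue_measure]_(x in `[0, 1]) (S N).[x])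
    @ \oo --> \int[lebesgue_measure]_(x in `[0, 1]) (phi k r x * q.[x]).
  exact: fine_cvg int_cvg.
apply: (near_eq_cvgn _ (cvgM (cvg_cst r) int_cvg)); apply: nearW => N /=.
rewrite Rintegral_horner // horner0_antideriv subr0 -/(integ01 (S N)).
rewrite /S linearZ /= mulVKf ?gt_eqF // linear_sum /=.
by apply: eq_bigr => i _; rewrite linearZ.
Qed.

Lemma cvg_avoid_vol m r : is_growth_rate m.+2 r ->
  exists2 C : R, 0 < C & (fun n => avoid_vol R m n / r ^+ n) @ \oo --> C.
Proof.
move=> [r0 [C [g [C0 /andP[g0 g1] [e eO near_e]]]]]; exists C => //.
have e0 : e @ \oo --> (0 : R).
  by apply: eqO_cvg0 eO _; apply: cvg_expr; rewrite ger0_norm.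
have : (fun n => C * (1 + e n)) @ \oo --> C.
  rewrite -[X in _ --> X]mulr1 -[in X in _ --> X](addr0 1).
  apply: cvgM; first exact: cvg_cst.
  by apply: cvgD => //; exact: cvg_cst.
apply: near_eq_cvgn; near=> n.
rewrite avoid_volE (near near_e n) //.
have : n`!%:R != 0 :> R by rewrite pnatr_eq0 -lt0n fact_gt0.
have : r ^+ n != 0 by rewrite expf_neq0 ?gt_eqF.
by move=> rn nn; field; rewrite rn nn.
Unshelve. all: by end_near. Qed.

(** The terms of the expansion of [avoid_int] converge one by one after division
    by r^n and are dominated geometrically, so the expansion passes to the
    limit. *)
Lemma cvg_avoid_int m r q C l : 0 < r ->
  (fun n => avoid_vol R m n / r ^+ n) @ \oo --> C ->
  (fun n => avoid_int m n q / r ^+ n) @ \oo --> l ->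
  (fun N => \sum_(i < N) C * ((-1) ^+ i * r^-1 ^+ phi_exp m.+2 i
                * integ01 (divpow R (phi_exp m.+2 i) * q))) @ \oo --> l.
Proof.
move=> r0 volC; have [M1 M1_ge0 vol_bound] := cvg_seq_bound volC.
have [M2 M2_ge0 exp_bound] := phi_exp_bound r^-1.
have termE n i : (phi_exp m.+2 i <= n)%N -> avoid_term m n q i / r ^+ n =
    avoid_vol R m (n - phi_exp m.+2 i) / r ^+ (n - phi_exp m.+2 i) *
    ((-1) ^+ i * r^-1 ^+ phi_exp m.+2 i
       * integ01 (divpow R (phi_exp m.+2 i) * q)).
  move=> le_en; rewrite /avoid_term le_en integ01_iter_fall.
  rewrite -{2}(subnK le_en) exprD invfM exprVn; ring.
apply: (@tannery _ (fun n i => avoid_term m n q i / r ^+ n)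
  (fun i => C * ((-1) ^+ i * r^-1 ^+ phi_exp m.+2 i
                * integ01 (divpow R (phi_exp m.+2 i) * q)))
  (fun n => avoid_int m n q / r ^+ n) l (M1 * (M2 * coef_norm q))).
- move=> n i; have [le_en|lt_ne] := leqP (phi_exp m.+2 i) n; last first.
    rewrite /avoid_term leqNgt lt_ne mul0r normr0.
    by rewrite !mulr_ge0 ?coef_norm_ge0 ?exprn_ge0 ?invr_ge0.
  rewrite termE // normrM -[leRHS]mulrA ler_pM //.
  rewrite 2!normrM normrX normrN1 expr1n mul1r normrX.
  apply: le_trans (ler_wpM2l _ (integ01_divpowM_bound q _)) _.
    by rewrite exprn_ge0.
  rewrite -/(coef_norm q) mulrCA mulrAC mulrC ler_wpM2r ?coef_norm_ge0 //.
  exact: exp_bound.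
- move=> i; rewrite -(cvg_shiftn (phi_exp m.+2 i)) /=.
  under eq_fun do rewrite termE ?leq_addl // addnK.
  by apply: cvgM => //; exact: cvg_cst.
- move=> n N0; exists (maxn N0 n).+1.*2; first by rewrite -addnn; lia.
  rewrite (@avoid_int_sum _ _ (maxn N0 n).+1) ?mulr_suml //.
  by apply: leq_trans (leq_pmulr _ _) => //; rewrite ltnS leq_maxr.
Qed.

(** The same quotient computed from the hypothesis on c; the shift by t + 2 is
    the length of the prefix and of the first letter after it. *)
Lemma cvg_run_constant m I t r c C : 0 < r ->
  is_run_constant m.+2 I c ->
  I != fset0 -> 0%N \notin I -> t.+1 = (\max_(i <- I) i + m.+2 - 1)%N ->
  (fun n => avoid_vol R m n / r ^+ n) @ \oo --> C ->
  (fun n => avoid_int m n (rise (runs_poly R m.+2 I t)) / r ^+ n) @ \oo -->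
    c * C * r ^+ t.+2.
Proof.
move=> r0 [e eO near_e] I_neq0 I0 def_t volC.
have e0 : e @ \oo --> (0 : R).
  apply: eqO_cvg0 eO _; apply: powR_cvg0; lra.
have ratio : (fun n => (num_runs m.+2 I n)%:R / n`!%:R / r ^+ n) @ \oo -->
    c * C.
  have : (fun n => c * (avoid_vol R m n / r ^+ n) * (1 + e n)) @ \oo --> c * C.
    rewrite -[X in _ --> X]mulr1 -[in X in _ --> X](addr0 1).
    apply: cvgM; first by apply: cvgM => //; exact: cvg_cst.
    by apply: cvgD => //; exact: cvg_cst.
  apply: near_eq_cvgn; near=> n.
  by rewrite avoid_volE (near near_e n) //; ring.
rewrite -(cvg_shiftn t.+2) in ratio.
apply: (near_eq_cvgn _ (cvgM ratio (cvg_cst (r ^+ t.+2)))).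
apply: nearW => n /=.
rewrite addnC addSnnS num_runs_avoid_int //.
have nn : (t.+1 + n.+1)`!%:R != 0 :> R by rewrite pnatr_eq0 -lt0n fact_gt0.
have -> : r ^+ (t.+1 + n.+1) = r ^+ n * r ^+ t.+2.
  by rewrite -exprD; congr (_ ^+ _); lia.
have rn : r ^+ n != 0 by rewrite expf_neq0 ?gt_eqF.
have rt : r ^+ t.+2 != 0 by rewrite expf_neq0 ?gt_eqF.
by field; rewrite nn rn rt.
Unshelve. all: by end_near. Qed.

End Limits.

Theorem proposition5p5 (R : realType) (k : nat) (I : {fset nat}) (t : nat)
    (r c : R)
    (hk : (3 <= k)%N)
    (hI0 : I != fset0)
    (hIpos : 0%N \notin I)
    (ht : t = (\max_(i <- I) i + k - 1)%N)
    (hr : is_growth_rate k r)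
    (hc : is_run_constant k I c) :
  c = (t`!%:R * r ^+ t)^-1 *
    \int[lebesgue_measure]_(x in `[0, 1])
      (phi k r x *
       \int[lebesgue_measure]_(y in `[0, x])
         (\sum_(1 <= s < t.+1)
            (num_runs_first k (reflect_runs k t I) (t + 1 - s) t)%:R
            * order_density t s y)).
Proof.
case: k hk ht hr hc => [|[|m]] // _ ht hr hc.
case: t ht => [|t] ht; first by lia.
have leI i : i \in I -> (i + m.+2 <= t.+1 + 2)%N.
  by move=> Ii; have : (i <= \max_(j <- I) j)%N by [exact: leq_bigmax_seq]; lia.
have r0 : 0 < r by case: hr.
have [C C0 volC] := cvg_avoid_vol hr.
set P := runs_poly R m.+2 I t.
pose Q := (t.+1)`!%:R *: rise P.
have -> : \int[lebesgue_measure]_(x in `[0, 1])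
      (phi m.+2 r x *
       \int[lebesgue_measure]_(y in `[0, x])
         (\sum_(1 <= s < t.+2)
            (num_runs_first m.+2 (reflect_runs m.+2 t.+1 I)
               (t.+1 + 1 - s) t.+1)%:R
            * order_density t.+1 s y)) =
    \int[lebesgue_measure]_(x in `[0, 1]) (phi m.+2 r x * Q.[x]).
  apply: eq_Rintegral => x; rewrite inE /= in_itv /= => /andP[x0 _].
  congr (_ * _).
  transitivity (\int[lebesgue_measure]_(y in `[0, x]) ((t.+1)`!%:R *: P).[y]).
    by apply: eq_Rintegral => y _; rewrite sum_order_density // hornerZ.
  by rewrite Rintegral_horner // horner0_antideriv subr0 linearZ.
have := cvg_run_constant r0 hc hI0 hIpos ht volC.
move/(cvg_avoid_int r0 volC) => cvg_c.
have cvg_phi := @cvg_phi_integral R m.+2 r Q isT r0.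
have cvg_Q : (fun N => \sum_(i < N) (-1) ^+ i * r^-1 ^+ phi_exp m.+2 i
    * integ01 (divpow R (phi_exp m.+2 i) * Q) : R) @ \oo -->
    ((t.+1)`!%:R / C * (c * C * r ^+ t.+2) : R).
  apply: (near_eq_cvgn _ (cvgM (cvg_cst ((t.+1)`!%:R / C)) cvg_c)).
  apply: nearW => N /=.
  rewrite mulr_sumr; apply: eq_bigr => i _.
  have -> : integ01 (divpow R (phi_exp m.+2 i) * Q) =
      (t.+1)`!%:R * integ01 (divpow R (phi_exp m.+2 i) * rise P).
    by rewrite /Q -scalerAr linearZ.
  by rewrite -/P; field; rewrite gt_eqF.
have nn : (t.+1)`!%:R != 0 :> R by rewrite pnatr_eq0 -lt0n fact_gt0.
have rn : r ^+ t.+1 != 0 by rewrite expf_neq0 ?gt_eqF.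
have := cvg_unique _ cvg_phi cvg_Q => /(_ (@norm_hausdorff _ _)).
rewrite exprS; set J := \int[_]_(_ in _) _ => eJ.
have {eJ} -> : J = (t.+1)`!%:R * c * r ^+ t.+1.
  apply: (mulfI (lt0r_neq0 r0)); rewrite eJ; field.
  by rewrite gt_eqF.
by field; rewrite nn rn.
Qed.
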